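(* Let $\tau$ be a finite relational signature, let $A\in\mathsf{FIN}(\tau)$, and let $\mathcal{C}$ be either $[A]_{\leftrightarrow}$ or $\uparrow A$. Then the following are equivalent: (i) $\mathcal{C}$ is decided by an adaptive right unbounded query algorithm over $\mathbb{B}$; (ii) $\mathcal{C}$ is decided by a non-adaptive right $k$-query algorithm over $\mathbb{B}$ for some $k$.
   Context: $\mathsf{FIN}(\tau)$ is the class of finite relational structures of signature $\tau$ with non-empty domain. $B\to A$ means there is a homomorphism from $B$ to $A$; $[A]_{\leftrightarrow}=\{B: A\to B\text{ and } B\to A\}$, $\uparrow A=\{B: A\to B\}$. $\hom_{\mathbb{B}}(D,F)$ is $1$ if $D\to F$ and $0$ otherwise. A non-adaptive right $k$-query algorithm over $\mathbb{B}$ is a pair $((F_1,\dots,F_k),X)$ with $F_i\in\mathsf{FIN}(\tau)$ and $X\subseteq\{0,1\}^k$; it decides $\{D:(\hom_{\mathbb{B}}(D,F_i))_{i=1}^k\in X\}$. For a set $\Sigma$, $\Sigma^{<\omega}$ is the set of finite strings over $\Sigma$; a subtree is a prefix-closed subset, a leaf an element with no proper extension. An adaptive right unbounded query algorithm over $\mathbb{B}$ is a function $G:\mathcal{T}\to\mathsf{FIN}(\tau)\cup\{\mathsf{YES},\mathsf{NO}\}$ with $\mathcal{T}\subseteq\{0,1\}^{<\omega}$ a subtree and $G(\sigma)\in\{\mathsf{YES},\mathsf{NO}\}$ iff $\sigma$ is a leaf; its computation path on $D$ is the limit of $\sigma_0=\varepsilon$, $\sigma_{i+1}=\sigma_i$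 if $G(\sigma_i)\in\{\mathsf{YES},\mathsf{NO}\}$, else $\sigma_{i+1}=\sigma_i\bullet\hom_{\mathbb{B}}(D,G(\sigma_i))$; it must be total (finite path on every input) and decides $\{D:G(\text{path of }D)=\mathsf{YES}\}$. *)

(* Defs.v *)
From mathcomp Require Import all_boot.

Set Implicit Arguments.
Unset Strict Implicit.
Unset Printing Implicit Defensive.

Record signature := Signature {
  symbol : finType;
  arity : symbol -> nat
}.

Record FIN (tau : signature) := Structure {
  dom :> finType;
  dom_nonempty : 0 < #|dom|;
  interp : forall R : symbol tau, {set (arity R).-tuple dom}
}.

Definition is_hom (tau : signature) (A B : FIN tau) (h : A -> B) : bool :=
  [forall R : symbol tau, forall t in interp A R,
     map_tuple h t \in interp B R].

Definition hom_to (tau : signature) (A B : FIN tau) : Prop :=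
  exists h : A -> B, is_hom h.

(* The query value; finite functions make the existential boolean. *)
Definition homB (tau : signature) (D F : FIN tau) : bool :=
  [exists h : {ffun D -> F}, is_hom h].

Lemma homBP (tau : signature) (D F : FIN tau) : reflect (hom_to D F) (homB D F).
Proof.
apply: (iffP existsP) => [[h hh]|[h hh]]; first by exists h.
exists (finfun h); apply/forallP => R; apply/forall_inP => t tR.
have -> : map_tuple (finfun h) t = map_tuple h t.
  by apply: val_inj; apply: eq_map => x; rewrite ffunE.
by move/forallP/(_ R)/forall_inP: hh => /(_ t tR).
Qed.

Definition hom_equiv_class (tau : signature) (A : FIN tau) : FIN tau -> Prop :=
  fun B => hom_to A B /\ hom_to B A.

Definition up_set (tau : signature) (A : FIN tau) : FIN tau -> Prop :=
  fun B => hom_to A B.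

Record nonadaptive_alg (tau : signature) (k : nat) := NonAdaptive {
  queries : 'I_k -> FIN tau;
  accept : {set k.-tuple bool}
}.

Definition nonadaptive_decides (tau : signature) (k : nat)
    (N : nonadaptive_alg tau k) (C : FIN tau -> Prop) : Prop :=
  forall D : FIN tau,
    C D <-> [tuple homB D (queries N i) | i < k] \in accept N.

Definition subtree (Sigma : eqType) (T : seq Sigma -> Prop) : Prop :=
  forall s t : seq Sigma, prefix s t -> T t -> T s.

Definition leaf (Sigma : eqType) (T : seq Sigma -> Prop) (s : seq Sigma) : Prop :=
  T s /\ forall t : seq Sigma, T t -> prefix s t -> t = s.

Variant node (tau : signature) := Query of FIN tau | YES | NO.
Arguments YES {tau}.
Arguments NO {tau}.

Definition is_answer (tau : signature) (v : node tau) : bool :=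
  if v is Query _ then false else true.

(* [label] is the algorithm's function on [tree]; its values outside [tree]
   are irrelevant, see [path_on]. *)
Record adaptive_alg (tau : signature) := Adaptive {
  tree : seq bool -> Prop;
  label : seq bool -> node tau;
  tree_subtree : subtree tree;
  answer_leaf : forall s, tree s -> (is_answer (label s) <-> leaf tree s)
}.

Definition step (tau : signature) (G : adaptive_alg tau) (D : FIN tau)
    (s : seq bool) : seq bool :=
  if label G s is Query F then rcons s (homB D F) else s.

Definition run (tau : signature) (G : adaptive_alg tau) (D : FIN tau) (i : nat) :
  seq bool := iter i (step G D) [::].

(* The computation path of G on D exists, is finite and equals s.  A sequence of
   strings converges to a finite string iff it is eventually equal to it.  Every
   [run G D i] is a prefix of the limit s, so [tree G s] keeps the whole
   computation inside the tree. *)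
Definition path_on (tau : signature) (G : adaptive_alg tau) (D : FIN tau)
    (s : seq bool) : Prop :=
  tree G s /\ exists n, forall i, n <= i -> run G D i = s.

Definition total (tau : signature) (G : adaptive_alg tau) : Prop :=
  forall D : FIN tau, exists s, path_on G D s.

Definition adaptive_decides (tau : signature) (G : adaptive_alg tau)
    (C : FIN tau -> Prop) : Prop :=
  total G /\
  forall D : FIN tau, C D <-> exists2 s, path_on G D s & label G s = YES.

(* Main.v *)
Require Import Defs.
From mathcomp Require Import all_boot.

(** Let [Fs] be the queries asked by the adaptive algorithm on its run on [A],
    and [Ns] those to which [A] has no homomorphism.  If [D -> A] and [D] maps to
    no member of [Ns], then [D] answers all of [Fs] as [A] does, so it is accepted
    and [A -> D].  Conversely [A -> D] forbids [D -> F] for [F] in [Ns].  Hence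
    [[A]] is decided by the queries [A] and [Ns].  For the up-set apply this to
    [D x A], which always maps to [A]: [D x A -> F] iff [D -> F^A], so the
    queries [F^A] for [F] in [Ns] decide it. *)

Set Implicit Arguments.
Unset Strict Implicit.
Unset Printing Implicit Defensive.

Section Homomorphisms.
Variable tau : signature.
Implicit Types A B D F : FIN tau.

Lemma is_homP A B (h : A -> B) :
  reflect (forall R t, t \in interp A R -> map_tuple h t \in interp B R)
          (is_hom h).
Proof.
apply: (iffP forallP) => hh R; first by move=> t; apply: (forall_inP (hh R)).
by apply/forall_inP => t; apply: hh.
Qed.

Lemma hom_refl A : hom_to A A.
Proof.
exists id; apply/is_homP => R t.
by rewrite (_ : map_tuple id t = t) //; apply: val_inj; rewrite /= map_id.
Qed.

Lemma hom_trans A B D : hom_to A B -> hom_to B D -> hom_to A D.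
Proof.
move=> [f /is_homP hf] [g /is_homP hg]; exists (g \o f); apply/is_homP => R t tR.
rewrite (_ : map_tuple _ t = map_tuple g (map_tuple f t)); first exact/hg/hf.
by apply: val_inj; rewrite /= map_comp.
Qed.

Lemma dom_prod_nonempty A B : 0 < #|{: A * B}|.
Proof. by rewrite card_prod muln_gt0 !dom_nonempty. Qed.

Definition prod_structure A B : FIN tau :=
  @Structure tau (A * B)%type (dom_prod_nonempty A B) (fun R =>
    [set t | (map_tuple fst t \in interp A R) && (map_tuple snd t \in interp B R)]).

Lemma hom_prodl A B : hom_to (prod_structure A B) A.
Proof. by exists fst; apply/is_homP => R t; rewrite inE => /andP[]. Qed.

Lemma hom_prodr A B : hom_to (prod_structure A B) B.
Proof. by exists snd; apply/is_homP => R t; rewrite inE => /andP[]. Qed.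

Lemma hom_pair D A B : hom_to D A -> hom_to D B -> hom_to D (prod_structure A B).
Proof.
move=> [f /is_homP hf] [g /is_homP hg]; exists (fun x => (f x, g x)).
apply/is_homP => R t tR; rewrite inE; apply/andP; split.
- rewrite (_ : map_tuple _ _ = map_tuple f t); first exact: hf.
  by apply: val_inj; rewrite /= -map_comp.
- rewrite (_ : map_tuple _ _ = map_tuple g t); first exact: hg.
  by apply: val_inj; rewrite /= -map_comp.
Qed.

Lemma dom_exp_nonempty F A : 0 < #|{ffun A -> F}|.
Proof. by rewrite card_ffun expn_gt0 dom_nonempty. Qed.

(** The exponential object in the category of structures; the relation is the one that makes
    evaluation [exp_structure F A] times [A] to [F] a homomorphism. *)
Definition exp_structure F A : FIN tau :=
  @Structure tau {ffun A -> F} (dom_exp_nonempty F A) (fun R =>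
    [set t | [forall u in interp A R,
       [tuple (tnth t i : {ffun A -> F}) (tnth u i) | i < arity R]
         \in interp F R]]).

Lemma hom_curry D A F :
  hom_to (prod_structure D A) F <-> hom_to D (exp_structure F A).
Proof.
split=> [[h /is_homP hh]|[h /is_homP hh]].
- exists (fun d => [ffun a => h (d, a)]); apply/is_homP => R t tR.
  rewrite inE; apply/forall_inP => u uR.
  (* Zipping [t] and [u] gives a related tuple of the product, on which [h] is known to preserve
     [R]. *)
  pose w : (arity R).-tuple (prod_structure D A) :=
    [tuple (tnth t i, tnth u i) | i < arity R].
  have w1 : map_tuple (@fst D A) w = t.
    by apply: eq_from_tnth => i; rewrite tnth_map tnth_mktuple.
  have w2 : map_tuple (@snd D A) w = u.
    by apply: eq_from_tnth => i; rewrite tnth_map tnth_mktuple.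
  have /hh: w \in interp (prod_structure D A) R by rewrite inE w1 w2 tR.
  set v := map_tuple h w; set v' := (X in _ -> X \in _); suff -> : v = v' by [].
  by apply: eq_from_tnth => i; rewrite tnth_map !tnth_mktuple tnth_map ffunE.
- exists (fun p => (h p.1 : {ffun A -> F}) p.2); apply/is_homP => R t.
  rewrite inE => /andP[t1 t2]; have := hh R _ t1.
  rewrite inE => /forall_inP/(_ _ t2).
  set v := (X in X \in _ -> _); set v' := map_tuple _ t; suff -> : v = v' by [].
  by apply: eq_from_tnth => i; rewrite tnth_mktuple !tnth_map.
Qed.

End Homomorphisms.

Section Algorithms.
Variable tau : signature.
Implicit Types (A D F : FIN tau) (C : FIN tau -> Prop) (G : adaptive_alg tau).

(** Non-adaptive algorithms with lists in place of tuples, so that queries can be consed and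
    filtered without tracking [k]. *)
Definition seq_decides (Fs : seq (FIN tau)) (X : pred (seq bool)) C : Prop :=
  forall D, C D <-> X (map (homB D) Fs).

Lemma nonadaptive_seqP A C :
  (exists (k : nat) (N : nonadaptive_alg tau k), nonadaptive_decides N C) <->
  (exists Fs X, seq_decides Fs X C).
Proof.
split=> [[k [N hN]]|[Fs [X hX]]].
- exists (map (queries N) (enum 'I_k)).
  exists (fun s => [exists t in accept N, tval t == s]) => D.
  apply: (iff_trans (hN D)); rewrite -map_comp.
  split=> [Nt|/exists_inP[t Nt /eqP tE]].
    by apply/exists_inP; eexists; [exact: Nt | rewrite /= enumT].
  by rewrite (_ : [tuple _ | i < k] = t) //; apply: val_inj; rewrite /= tE enumT.
- exists (size Fs).
  (* [A] is only the default of [nth]; every index is below [size Fs]. *)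
  exists (NonAdaptive (fun i => nth A Fs i) [set t : (size Fs).-tuple bool | X t]).
  move=> D; apply: (iff_trans (hX D)); rewrite inE (_ : tval _ = map (homB D) Fs) //.
  by rewrite -[in RHS](mkseq_nth A Fs) /mkseq -val_enum_ord /= -!map_comp.
Qed.

Section AdaptiveOfSeq.
Variables (Fs : seq (FIN tau)) (X : pred (seq bool)).

(** The complete binary tree of depth [size Fs]. A node's query depends on its depth alone, and [X]
    is consulted at the bottom. *)
Let T (s : seq bool) : Prop := size s <= size Fs.

Let lab (s : seq bool) : node tau :=
  if drop (size s) Fs is F :: _ then Query F else if X s then YES else NO.

Let T_subtree : subtree T.
Proof. by move=> s t /size_prefix; apply: leq_trans. Qed.

Let lab_leaf s : T s -> (is_answer (lab s) <-> leaf T s).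
Proof.
rewrite /T /leaf /lab => sT.
(* With no query left, [s] already has maximal length, so it has no proper extension in the tree.
   Otherwise [rcons s true] is one. *)
case E: (drop (size s) Fs) => [|F Fs'].
- rewrite (_ : is_answer _ = true); last by case: ifP.
  split=> // _; split=> // t tT /prefixP[u tE].
  have := congr1 size E; rewrite size_drop => /eqP; rewrite subn_eq0 => leFs.
  move: tT; rewrite /T tE size_cat => /leq_trans/(_ leFs).
  by rewrite -{2}[size s]addn0 leq_add2l leqn0 => /nilP ->; rewrite cats0.
- split=> // -[_ /(_ (rcons s true))].
  have lt_s : size s < size Fs by rewrite -subn_gt0 -size_drop E.
  by rewrite /T size_rcons prefix_rcons => /(_ lt_s isT)/(congr1 size)/eqP;
     rewrite size_rcons -{2}[size s]addn0 -addn1 eqn_add2l.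
Qed.

Definition adaptive_of_seq := Adaptive T_subtree lab_leaf.

Lemma run_adaptive_of_seq D i :
  run adaptive_of_seq D i = map (homB D) (take i Fs).
Proof.
elim: i => [|i IHi]; first by rewrite take0.
rewrite /run iterS -/(run _ _ _) IHi /step /= /lab size_map.
have [lei|lti] := leqP (size Fs) i.
  by rewrite !take_oversize ?(leq_trans lei) // drop_size; case: ifP.
rewrite size_takel ?(ltnW lti) //.
case E: (drop i Fs) => [|F Fs'].
  by have := size_drop i Fs; rewrite E => /esym/eqP; rewrite subn_eq0 leqNgt lti.
by rewrite (take_nth F lti) map_rcons -[i in nth _ _ i]addn0 -nth_drop E.
Qed.

Lemma adaptive_of_seq_decides C :
  seq_decides Fs X C -> adaptive_decides adaptive_of_seq C.
Proof.
move=> hX; have pathD D : path_on adaptive_of_seq D (map (homB D) Fs).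
  split; first by rewrite /= /T size_map.
  by exists (size Fs) => i lei; rewrite run_adaptive_of_seq take_oversize.
have labD D : label adaptive_of_seq (map (homB D) Fs) =
    if X (map (homB D) Fs) then YES else NO.
  by rewrite /= /lab size_map drop_size.
split=> [D|D]; first by exists (map (homB D) Fs).
apply: (iff_trans (hX D)); split=> [XD|[s [_ [n runD]]]].
  by exists (map (homB D) Fs); rewrite // labD XD.
(* The limit of a run is unique: two eventual values are compared at a step beyond both bounds. *)
have [_ [m runD']] := pathD D.
rewrite -(runD _ (leq_maxl n m)) (runD' _ (leq_maxr n m)) labD.
by case: (X _).
Qed.

End AdaptiveOfSeq.

(** The list collects the queries met along the first [n] steps on [A]. As long as the answers
    agree, [D] visits the same nodes and hence meets the same queries. *)
Lemma run_finite_queries G A n : exists Fs,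
  forall D, all (fun F => homB D F == homB A F) Fs -> run G D n = run G A n.
Proof.
elim: n => [|n [Fs IHn]]; first by exists [::].
exists (if label G (run G A n) is Query F then F :: Fs else Fs) => D.
rewrite /run !iterS -!/(run _ _ _) /step.
case E: (label _ _) => [F||] /=; last 2 first.
- by move=> /IHn ->; rewrite E.
- by move=> /IHn ->; rewrite E.
- by case/andP=> /eqP DF /IHn ->; rewrite E DF.
Qed.

Lemma adaptive_obstructions G A C : adaptive_decides G C -> C A ->
  exists Ns, ~~ has (homB A) Ns /\
    forall D, hom_to D A -> ~~ has (homB D) Ns -> C D.
Proof.
move=> [_ hG] /hG [s [Ts [n runA]] sYES].
have [Fs hFs] := run_finite_queries G A n.
exists [seq F <- Fs | ~~ homB A F]; split=> [|D DA noD].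
  by rewrite -all_predC filter_all.
have runD : run G D n = s.
  rewrite hFs ?runA //; elim: Fs noD {hFs} => //= F Fs IH.
  case: ifPn => [nAF|/negPn AF] /=.
    by rewrite negb_or => /andP[/negbTE-> /IH ->]; rewrite (negbTE nAF) eqxx.
  move=> /IH ->; rewrite AF andbT; apply/eqP/homBP.
  exact: hom_trans DA (homBP _ _ AF).
(* The run on [D] stays at [s] from step [n] on, because [s] carries an answer. *)
apply/hG; exists s => //; split=> //; exists n => i /subnK <-.
elim: (i - n) => // j IHj.
by rewrite addSn /run iterS -/(run _ _ _) IHj /step sYES.
Qed.

End Algorithms.

Theorem theorem31 (tau : signature) (A : FIN tau) (C : FIN tau -> Prop)
    (hC : C = hom_equiv_class A \/ C = up_set A) :
  (exists G : adaptive_alg tau, adaptive_decides G C) <->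
  (exists (k : nat) (N : nonadaptive_alg tau k), nonadaptive_decides N C).
Proof.
split=> [[G hG]|/(nonadaptive_seqP A)[Fs [X /adaptive_of_seq_decides hX]]]; last first.
  by eexists; exact: hX.
have CA : C A by case: hC => ->; [split|]; exact: hom_refl.
have C_up D : C D -> hom_to A D by case: hC => -> // -[].
have [Ns [noA hNs]] := adaptive_obstructions hG CA.
have noUp D : hom_to A D -> ~~ has (homB D) Ns.
  move=> AD; apply: contra noA; apply: sub_has => F /homBP DF.
  exact/homBP/(hom_trans AD).
apply/(nonadaptive_seqP A); case: hC => {hG} hC.
(* The head is the answer to the query [A] and must be positive; the remaining answers must all be
   negative. *)
- exists (A :: Ns), (fun s => head false s && ~~ has id (behead s)) => D.
  rewrite /= has_map; split=> [|/andP[/homBP DA noD]]; last exact: hNs.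
  by rewrite hC => -[AD DA]; apply/andP; split; [exact/homBP | exact: noUp].
- exists (map (fun F => exp_structure F A) Ns), (fun s => ~~ has id s) => D.
  (* By currying, the answers of [D] to the exponentials are those of the product to [Ns]. *)
  rewrite !has_map (_ : has _ _ = has (homB (prod_structure D A)) Ns).
    rewrite hC; split=> [AD|noDA].
      by apply: noUp; apply: hom_pair AD (hom_refl A).
    apply: hom_trans (hom_prodl D A); apply: C_up.
    exact: hNs (hom_prodr D A) noDA.
  by apply: eq_has => F; apply/homBP/homBP => /hom_curry.
Qed.
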